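(* Let $\beta$ be a Pisot unit such that the unit group $\mathcal{O}_{\mathbb{Q}(\beta)}^*$ of the ring of integers of $\mathbb{Q}(\beta)$ has rank $1$. Let $I$ be an arbitrary subset of $\mathbb{N}_0$. Then the set $\{\beta^i \mid i \in I\}$ is a generalised polynomial subset of the number field $\mathbb{Q}(\beta)$.
   Context: $\mathbb{N}_0=\{0,1,2,\dots\}$. A conjugate of an algebraic number is any complex root of its minimal polynomial over $\mathbb{Q}$. A Pisot unit is a real algebraic number $\beta>1$ that is a unit (both $\beta$ and $1/\beta$ are algebraic integers) and such that all conjugates $\alpha\neq\beta$ of $\beta$ satisfy $|\alpha|<1$. Generalised polynomials on number fields: for a finite-dimensional real vector space $V$, the class of real-valued generalised polynomial maps $V\to\mathbb{R}$ is the smallest class of functions containing constants and linear functionals and closed under addition, multiplication, and $f\mapsto\lfloor f\rfloor$. A map $V\to\mathbb{C}$ is generalised polynomial if its real and imaginary parts are. For a number field $K$ put $K_{\mathbb{R}}=K\otimes_{\mathbb{Q}}\mathbb{R}$ and $\iota\colon K\to K_{\mathbb{R}}$, $\iota(x)=x\otimes 1$. A map $f\colon K\to\mathbb{C}$ is a generalised polynomial map on $K$ if $f=\tilde f\circ\iota$ for some generalised polynomial map $\tilde f\colon K_{\mathbb{R}}\to\mathbb{C}$. A set $S\subseteq K$ is a generalised polynomial subset of $K$ if $1_S\colon K\to\mathbb{R}$ is a generalised polynomial map on $K$. *)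

(* Defs.v *)
From HB Require Import structures.
From mathcomp Require Import all_boot all_order all_algebra all_field.
From mathcomp Require Import boolp classical_sets reals numfun.
From mathcomp Require Import complex.

Set Implicit Arguments.
Unset Strict Implicit.
Unset Printing Implicit Defensive.

Import Order.TTheory GRing.Theory Num.Theory.
Local Open Scope ring_scope.
Local Open Scope complex_scope.

Definition minimal_polynomial (F : numFieldType) (x : F) (p : {poly rat}) : Prop :=
  [/\ p \is monic, root (map_poly ratr p) x &
      forall q : {poly rat}, q != 0 -> root (map_poly ratr q) x ->
        (size p <= size q)%N].

Definition conjugate (R : realType) (x a : R[i]) : Prop :=
  exists2 p : {poly rat}, minimal_polynomial x p & root (map_poly ratr p) a.

Definition algebraic_integer (F : numFieldType) (x : F) : Prop :=
  integralOver (intr : int -> F) x.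

Definition pisot_unit (R : realType) (beta : R) : Prop :=
  [/\ 1 < beta, algebraic_integer beta, algebraic_integer beta^-1 &
      forall a : R[i], conjugate beta%:C a -> a != beta%:C -> `|a| < 1].

(* The nonvanishing condition is needed because 0^-1 = 0. *)
Definition integer_unit (K : fieldExtType rat) (x : K) : Prop :=
  [/\ x != 0, integralOver (intr : int -> K) x &
      integralOver (intr : int -> K) x^-1].

Definition mul_independent (K : fieldType) (n : nat) (u : 'I_n -> K) : Prop :=
  forall e : 'I_n -> int, \prod_(i < n) u i ^ e i = 1 -> forall i, e i = 0.

(* The rank of an abelian group is the largest size of a family of elements
   that is linearly independent over the integers. *)
Definition unit_rank (K : fieldExtType rat) (r : nat) : Prop :=
  (exists u : 'I_r -> K, (forall i, integer_unit (u i)) /\ mul_independent u) /\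
  (forall (n : nat) (u : 'I_n -> K),
     (forall i, integer_unit (u i)) -> mul_independent u -> (n <= r)%N).

Inductive genpoly (R : realType) (V : vectType R) : (V -> R) -> Prop :=
| genpoly_cst (c : R) : genpoly (fun _ => c)
| genpoly_linear (l : {scalar V}) : genpoly l
| genpoly_add (f g : V -> R) :
    genpoly f -> genpoly g -> genpoly (fun v => f v + g v)
| genpoly_mul (f g : V -> R) :
    genpoly f -> genpoly g -> genpoly (fun v => f v * g v)
| genpoly_floor (f : V -> R) :
    genpoly f -> genpoly (fun v => (Num.floor (f v))%:~R).

Definition genpolyC (R : realType) (V : vectType R) (f : V -> R[i]) : Prop :=
  genpoly (fun v => complex.Re (f v)) /\ genpoly (fun v => complex.Im (f v)).

(* The real vector space underlying the tensor product of K and R over the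
   rationals, in the coordinates given by a rational basis of K, with the map
   x |-> x (x) 1. Lemma extend_realP is its universal property, which
   determines the pair up to a unique linear isomorphism. *)
Definition real_extension (R : realType) (K : fieldExtType rat) : vectType R :=
  'rV[R]_(\dim {:K}).

Definition extend_real (R : realType) (K : fieldExtType rat) (x : K) :
    real_extension R K :=
  \row_j ratr (coord (vbasis {:K}) j x).

Lemma extend_realP (R : realType) (K : fieldExtType rat) (W : lmodType R)
    (f : {additive K -> W}) :
  exists2 g : {linear real_extension R K -> W},
    forall x, g (extend_real R x) = f x &
    forall h : {linear real_extension R K -> W},
      (forall x, h (extend_real R x) = f x) -> h =1 g.
Proof.
have fZ (q : rat) x : f (q *: x) = ratr q *: f x.
  have d0 : (denq q)%:~R != 0 :> R by rewrite intr_eq0 denq_neq0.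
  apply: (scalerI d0); rewrite scalerA /ratr mulrCA divff // mulr1.
  rewrite !scaler_int -!(raddfMz f); congr (f _).
  by rewrite scalerMzl -mulrzr -numqE scaler_int.
pose e (j : 'I_(\dim {:K})) := (vbasis {:K})`_j.
pose g (v : real_extension R K) : W := \sum_j v 0 j *: f (e j).
have g_lin : linear g.
  move=> a u v; rewrite /g scaler_sumr -big_split; apply: eq_bigr => j _ /=.
  by rewrite !mxE scalerDl scalerA.
pose gM := GRing.isLinear.Build _ _ _ _ g g_lin.
pose gL : {linear real_extension R K -> W} := HB.pack g gM.
exists gL => [x | h hf v].
  rewrite [in RHS](coord_vbasis (memvf x)) raddf_sum /= /g.
  by apply: eq_bigr => j _; rewrite mxE fZ.
have ext_e (j : 'I_(\dim {:K})) : extend_real R (e j) = delta_mx 0 j :> 'rV_ _.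
  apply/rowP => i; rewrite !mxE eqxx /= /e coord_free ?(basis_free (vbasisP _)) //.
  by rewrite ratr_nat eq_sym.
rewrite [v in LHS]row_sum_delta linear_sum /= /g; apply: eq_bigr => j _.
by rewrite linearZ /= -ext_e hf.
Qed.

Definition genpoly_on (R : realType) (K : fieldExtType rat) (f : K -> R[i]) :
    Prop :=
  exists2 F : real_extension R K -> R[i],
    genpolyC F & forall x, f x = F (extend_real R x).

Definition genpoly_subset (R : realType) (K : fieldExtType rat) (S : set K) :
    Prop :=
  genpoly_on (fun x => (\1_S x : R)%:C).

(* Main.v *)
Require Import Defs.
From HB Require Import structures.
From mathcomp Require Import all_boot all_order all_algebra all_field.
From mathcomp Require Import boolp classical_sets reals numfun.
From mathcomp Require Import complex.
From mathcomp Require Import ring lra zify.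

Set Implicit Arguments.
Unset Strict Implicit.
Unset Printing Implicit Defensive.

Import Order.TTheory GRing.Theory Num.Theory.
Local Open Scope ring_scope.
Local Open Scope classical_set_scope.

(** Write [beta = sigma b], and let [G] be the group of units of the ring
    [Z[b]]. Three facts make the powers of [b] visible to generalised
    polynomials.

    Membership in [G] is a generalised polynomial condition: the coordinates of
    [x] in the basis [1, b, b^2, ...] have to be integers, and the determinant
    of multiplication by [x], a polynomial in these coordinates, has to be
    [1] or [-1] ([genpoly_order_unit]).

    Rank one says that every [x] in [G] satisfies [x ^ n = b ^ m] for some
    [n > 0]. Applying the other embeddings of the field to this relation, one
    sees that an [x] in [G] with [1 <= |sigma x| < beta] has all its conjugates
    bounded by [beta]. Only finitely many elements of [Z[b]] have this
    property, so a pigeonhole argument on the powers of [x], reduced modulo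
    powers of [b], gives one exponent [s > 0] such that [sigma x ^ s] is a power
    of [beta] for every [x] in [G] with [|sigma x| >= 1] ([uniform_exponent]).

    Finally, an arbitrary set [A] of natural numbers can be stored in one real
    parameter and read off by two floors ([exists_digit_test]). The conjugates
    of [b] other than [beta] lie in the open unit disc, so the integers
    [Tr(b ^ m)] are within [O(rho ^ m)] of [beta ^ m], with [rho < 1]. Let
    [B = beta ^ L] for a large [L], let [al] be the sum of [B ^ (- i)] over [i]
    in [A], and let [g = beta ^ (- j)] be small, with [j] fixed before [L]. In
    [g * al * B ^ k], the terms with [i < k] are close to integers, the terms
    with [i > k] are negligible compared to [g], and the term [i = k] is [g] or
    [0]. Hence the position of this number modulo [1] tells whether [k] is in
    [A].

    The indicator function of [{b ^ i | i in I}] is then the product of the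
    indicator functions of [G] and of [|sigma x| >= 1], of the test of [s * I]
    at [sigma x ^ s], which leaves only the elements [b ^ i] and [- b ^ i] with
    [i] in [I], and of the test of the set of all natural numbers at [sigma x],
    which for odd [L] rejects the numbers [- beta ^ i] ([genpoly_powers]). *)

(** * Reading a set of exponents from a real number *)

Lemma exists_expn_lt (R : realType) (r e : R) :
  0 <= r < 1 -> 0 < e -> exists N, forall n, (N <= n)%N -> r ^+ n < e.
Proof.
move=> /andP[r0 r1] e0.
have [->|rn0] := eqVneq r 0.
  by exists 1 => -[|n] // _; rewrite expr0n.
have rgt0 : 0 < r by rewrite lt_def rn0.
pose h := r^-1 - 1.
have h0 : 0 < h by rewrite /h subr_gt0 invf_gt1.
have bern n : 1 + n%:R * h <= (1 + h) ^+ n.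
  elim: n => [|n IH]; first by rewrite expr0 mul0r addr0.
  rewrite exprS.
  have nh : 0 <= n%:R * h by rewrite mulr_ge0 // ltW.
  have h1 : 0 <= 1 + h by lra.
  apply: le_trans (ler_wpM2l h1 IH).
  rewrite -natr1; nra.
exists (Num.bound (e^-1 / h)) => n Nn.
have := archi_boundP (_ : 0 <= e^-1 / h).
rewrite divr_ge0 ?invr_ge0 ?ltW // => /(_ isT) hb.
have hb' : e^-1 / h < n%:R by apply: lt_le_trans hb _; rewrite ler_nat.
rewrite ltr_pdivrMr // in hb'.
have rE : 1 + h = r^-1 by rewrite /h; lra.
have := bern n; rewrite rE exprVn => bn.
rewrite -[r ^+ n]invrK -[e]invrK ltf_pV2 ?posrE ?invr_gt0 ?exprn_gt0 //; lra.
Qed.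

Lemma exists_expn_gt (R : realType) (B M : R) : 1 < B ->
  exists N, forall n, (N <= n)%N -> M < B ^+ n.
Proof.
move=> B1; have B0 : 0 < B by lra.
have M0 : 0 < Num.max M 1 by rewrite lt_max ltr01 orbT.
have [||N hN] := @exists_expn_lt R B^-1 (Num.max M 1)^-1.
- by rewrite invr_ge0 ltW // invf_lt1.
- by rewrite invr_gt0.
exists N => n /hN; rewrite exprVn ltf_pV2 ?posrE ?exprn_gt0 // gt_max.
by case/andP.
Qed.

Lemma sum_geometric_le (R : realType) (r : R) (n : nat) : 0 <= r < 1 ->
  \sum_(i < n) r ^+ i <= (1 - r)^-1.
Proof.
move=> /andP[r0 r1]; have r1' : 0 < 1 - r by lra.
rewrite -[leRHS]mul1r ler_pdivlMr // mulrC -opprB mulNr -subrX1 opprB.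
by have := exprn_ge0 n r0; lra.
Qed.

(** The remainders are bounded by the sum of [B ^ (- i)] over [i > 0]: the
    partial sums increase, and adding this bound at the proper scale turns them
    into decreasing upper bounds, so their supremum works. *)
Lemma digit_expansion (R : realType) (B : R) (a : nat -> bool) : 1 < B ->
  exists al : R, forall k,
    0 <= al * B ^+ k - \sum_(i < k.+1) (a i)%:R * B ^+ (k - i) <= (B - 1)^-1.
Proof.
move=> B1; have B0 : 0 < B by lra.
have Bn0 : B != 0 by rewrite gt_eqF.
have B1' : 0 < B - 1 by lra.
pose s k : R := \sum_(i < k.+1) (a i)%:R * B ^- i.
have shiftE k : s k * B ^+ k = \sum_(i < k.+1) (a i)%:R * B ^+ (k - i).
  rewrite mulr_suml; apply: eq_bigr => i _.
  rewrite -mulrA; congr (_ * _).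
  have ik : (i <= k)%N by rewrite -ltnS.
  have -> : B ^+ k = B ^+ (k - i) * B ^+ i by rewrite -exprD subnK.
  by rewrite mulrCA mulVf ?mulr1 // expf_neq0.
have s_step k : s k.+1 = s k + (a k.+1)%:R * B ^- k.+1.
  by rewrite /s big_ord_recr.
(* [t k] is [s k] with all later digits replaced by ones. *)
pose t k := s k + (B - 1)^-1 * B ^- k.
have Bk0 k : 0 < B ^- k by rewrite invr_gt0 exprn_gt0.
have s_nd k l : s k <= s (k + l)%N.
  elim: l => [|l IH]; first by rewrite addn0.
  rewrite addnS s_step (le_trans IH) // lerDl mulr_ge0 //; exact: ltW.
have t_ni k l : t (k + l)%N <= t k.
  elim: l => [|l IH]; first by rewrite addn0.
  rewrite addnS (le_trans _ IH) // /t s_step -addrA lerD2l.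
  have -> : B ^- (k + l) = B * B ^- (k + l).+1.
    by rewrite exprS invfM mulrA divff // mul1r.
  have E : (B - 1)^-1 * (B * B ^- (k + l).+1)
      = (B - 1)^-1 * B ^- (k + l).+1 + B ^- (k + l).+1.
    rewrite mulrA; set D := B ^- (k + l).+1.
    by field; rewrite gt_eqF.
  rewrite E addrC lerD2l -{2}[B ^- _]mul1r ler_wpM2r ?(ltW (Bk0 _)) //.
  by rewrite lern1 leq_b1.
have st k l : s k <= t l.
  apply: (le_trans (s_nd k l)); rewrite addnC; apply: le_trans (t_ni l k).
  by rewrite /t lerDl mulr_ge0 ?ltW // invr_gt0.
pose S : set R := [set s k | k in setT].
have S0 : S !=set0 by exists (s 0%N); exists 0%N.
have Sub k : ubound S (t k) by move=> _ [l _ <-].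
exists (sup S) => k.
have l1 : s k <= sup S.
  by apply: ub_le_sup; [exists (t 0%N); apply: Sub | exists k].
have l2 : sup S <= t k by apply: ge_sup.
have Bk : 0 < B ^+ k by rewrite exprn_gt0.
rewrite -shiftE -mulrBl; apply/andP; split.
  by apply: mulr_ge0; [rewrite subr_ge0 | exact: ltW].
rewrite -ler_pdivlMr // -/(B ^- k); rewrite /t in l2; lra.
Qed.

(** Let [0 < g <= 1 / 4]. If [c * y ^+ L] is within [g / 4] of an integer [N] or
    of [N + g], then the two floors agree when [g] is present and differ by one
    when it is not. *)
Definition digit_test (R : realType) (c g : R) (L : nat) (y : R) : R :=
  1 + (Num.floor (c * y ^+ L - g / 2))%:~R
    - (Num.floor (c * y ^+ L + 1 / 2))%:~R.

Lemma digit_test_near (R : realType) (c g : R) (L : nat) (y : R) (N : int)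
    (a : bool) (d : R) :
  0 < g <= 1 / 4 -> `|d| <= g / 4 -> c * y ^+ L = N%:~R + a%:R * g + d ->
  digit_test c g L y = a%:R.
Proof.
move=> /andP[g0 g4] /[!ler_norml] /andP[d1 d2] E; rewrite /digit_test E.
have E2 : Num.floor (N%:~R + a%:R * g + d + 1 / 2) = N.
  by apply: floor_def; rewrite intrD; case: (a) => /=; apply/andP; split; lra.
rewrite E2; case: a {E E2} => /=.
  rewrite (@floor_def _ _ N); first lra.
  by rewrite intrD; apply/andP; split; lra.
rewrite (@floor_def _ _ (N - 1)); first by rewrite intrB; lra.
by rewrite subrK intrB; apply/andP; split; lra.
Qed.

(** For odd [L] the sign passes through the power. A number close to [- N] or to
    [- N - g] lies strictly between [- N - 1] and [- N] after subtraction of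
    [g / 2], so the digit reads zero in both cases. *)
Lemma digit_test_near_opp (R : realType) (c g : R) (L : nat) (y : R) (N : int)
    (a : bool) (d : R) :
  0 < g <= 1 / 4 -> `|d| <= g / 4 -> odd L ->
  c * y ^+ L = N%:~R + a%:R * g + d ->
  digit_test c g L (- y) = 0.
Proof.
move=> /andP[g0 g4] /[!ler_norml] /andP[d1 d2] Lodd E.
rewrite /digit_test exprNn -signr_odd Lodd expr1 mulN1r mulrN E.
set f := - _.
have -> : Num.floor (f - g / 2) = - N - 1.
  apply: floor_def; rewrite subrK intrB rmorphN /= /f.
  by case: a {E f} => /=; apply/andP; split; lra.
have -> : Num.floor (f + 1 / 2) = - N.
  apply: floor_def; rewrite intrD rmorphN /= /f.
  by case: a {E f} => /=; apply/andP; split; lra.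
by rewrite intrB rmorphN /=; lra.
Qed.

(** For [beta] a Pisot number, [u m] is the trace of [beta ^+ m]. The scale
    [g = beta ^- j] is there because the digit of the exponent [k] itself is
    multiplied by [beta ^+ 0 = 1] and would be invisible modulo [1]; the power
    [L] makes the contributions of all other digits small, modulo [1], compared
    to [g]. *)
Lemma exists_digit_test (R : realType) (beta C rho : R) (u : nat -> int)
    (a : nat -> bool) :
  1 < beta -> 0 <= rho < 1 ->
  (forall m, `|(u m)%:~R - beta ^+ m| <= C * rho ^+ m) ->
  exists c g L, forall k,
    digit_test c g L (beta ^+ k) = (a k)%:R /\
    digit_test c g L (- beta ^+ k) = 0.
Proof.
move=> b1 rho01 uP; have b0 : 0 < beta by lra.
have /andP[rho0 rho1] := rho01.
have C0 : 0 <= C.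
  by have := uP 0%N; rewrite !expr0 mulr1; apply: le_trans; exact: normr_ge0.
have [j /(_ j (leqnn j)) hj] := exists_expn_gt 4 b1.
pose g := beta ^- j.
have g0 : 0 < g by rewrite invr_gt0 exprn_gt0.
have g4 : g <= 1 / 4.
  by rewrite mul1r lef_pV2 ?posrE ?exprn_gt0 // ltW.
(* With [rho ^+ (L - j) < e], the geometric series of errors sums to less than
   [g / 8]. *)
pose e := g / 8 * (1 - rho) / (C + 1).
have e0 : 0 < e by rewrite divr_gt0 ?mulr_gt0 ?subr_gt0 //; lra.
have [N1 hN1] := exists_expn_lt rho01 e0.
(* [beta ^+ L > 9] bounds the remainder [1 / (B - 1)] by [1 / 8]. *)
have [N2 hN2] := exists_expn_gt 9 b1.
have [L [Lodd LN1 LN2 jL]] :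
    exists L, [/\ odd L, (N1 <= L - j)%N, (N2 <= L)%N & (j < L)%N].
  by clear; exists (2 * (N1 + N2 + j)).+1; split; [rewrite /= oddM | lia ..].
have BL : 9 < beta ^+ L by apply: hN2.
have rL : rho ^+ (L - j) < e by apply: hN1.
pose B := beta ^+ L.
have B1 : 1 < B by rewrite /B; lra.
have [al alP] := digit_expansion a B1.
exists (g * al), g, L => k.
pose N : int := \sum_(i < k) (a i : nat)%:Z * u (L * (k - i) - j)%N.
pose d := g * al * (beta ^+ k) ^+ L - (N%:~R + (a k)%:R * g).
suff dP : `|d| <= g / 4.
  have dE : g * al * (beta ^+ k) ^+ L = N%:~R + (a k)%:R * g + d.
    by rewrite /d addrC subrK.
  have gg : 0 < g <= 1 / 4 by rewrite g0 g4.
  split; first exact: digit_test_near dE.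
  exact: digit_test_near_opp dE.
have /andP[th0 th1] := alP k.
set th := (X in 0 <= X) in th0 th1.
have thg : g * th <= g / 8.
  rewrite ler_pM2l //; apply: (le_trans th1).
  by rewrite lef_pV2 ?posrE //; rewrite /B; lra.
have dE : d = g * th + \sum_(i < k) (a i)%:R *
    (beta ^+ (L * (k - i) - j) - (u (L * (k - i) - j)%N)%:~R).
  have alE : al * B ^+ k = th + \sum_(i < k.+1) (a i)%:R * B ^+ (k - i).
    by rewrite /th subrK.
  rewrite /d /N -exprM mulnC exprM -/B -mulrA alE.
  rewrite mulrDr -addrA; congr (_ + _).
  rewrite big_ord_recr /= subnn expr0 mulr1 mulrDr.
  rewrite rmorph_sum /= mulr_sumr opprD addrACA.
  rewrite [X in _ + X](_ : _ = 0) ?addr0; last by rewrite mulrC subrr.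
  rewrite -sumrB; apply: eq_bigr => i _.
  rewrite rmorphM /= mulrBr; congr (_ - _).
  rewrite mulrCA; congr (_ * _).
  have jLk : (j <= L * (k - i))%N.
    have ik : (0 < k - i)%N by rewrite subn_gt0.
    by apply: (leq_trans (ltnW jL)); rewrite leq_pmulr.
  rewrite /g /B -exprM -{1}(subnK jLk) exprD mulrC mulfK //.
  by rewrite expf_neq0 // gt_eqF.
have sP : `|\sum_(i < k) (a i)%:R *
    (beta ^+ (L * (k - i) - j) - (u (L * (k - i) - j)%N)%:~R)| <= g / 8.
  apply: (le_trans (ler_norm_sum _ _ _)).
  apply: (@le_trans _ _ (\sum_(i < k) C * rho ^+ (L - j) * rho ^+ (k - i.+1))).
    apply: ler_sum => i _; rewrite normrM distrC.
    have ik : (i < k)%N by [].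
    apply: (@le_trans _ _ (C * rho ^+ (L * (k - i) - j))).
      rewrite -[leRHS]mul1r; apply: ler_pM => //.
      by rewrite normr_nat lern1 leq_b1.
    rewrite -mulrA -exprD ler_wpM2l // ler_wiXn2l // ?(ltW rho1) //.
    rewrite -(subnSK ik) mulnS -addnBAC; last exact: ltnW.
    by rewrite leq_add2l leq_pmull // (leq_trans _ jL).
  rewrite -mulr_sumr (reindex_inj rev_ord_inj) /=.
  rewrite (eq_bigr (fun i : 'I_k => rho ^+ i)); last first.
    by move=> i _; rewrite subnSK // subKn // ltnW.
  apply: (@le_trans _ _ (C * e * (1 - rho)^-1)).
    apply: ler_pM; rewrite ?mulr_ge0 ?exprn_ge0 ?sumr_ge0 //.
    - by move=> i _; rewrite exprn_ge0.
    - by rewrite ler_wpM2l // ltW.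
    - exact: sum_geometric_le.
  have -> : C * e * (1 - rho)^-1 = g / 8 * (C / (C + 1)).
    rewrite /e; field; rewrite !gt_eqF //; lra.
  rewrite -[leRHS]mulr1 ler_wpM2l //; first lra.
  by rewrite ler_pdivrMr; lra.
rewrite dE; apply: (le_trans (ler_normD _ _)).
rewrite ger0_norm; last by rewrite mulr_ge0 // ltW.
lra.
Qed.

(** * Generalised polynomial functions on a number field *)

Lemma sqrt2_irrational (R : realType) (m n : int) :
  m%:~R * Num.sqrt 2 = n%:~R :> R -> m = 0.
Proof.
move=> E; apply/eqP; rewrite -absz_eq0; apply/negPn/negP => m0.
have E2 : (m ^+ 2 * 2)%:~R = (n ^+ 2)%:~R :> R.
  rewrite rmorphM !rmorphXn /= -E exprMn; congr (_ * _).
  by rewrite sqr_sqrtr.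
move/intr_inj: E2 => /(congr1 absz); rewrite abszM !abszX => E2.
have := congr1 (logn 2) E2.
rewrite lognM ?expn_gt0 ?lt0n ?m0 // !lognX /= addn1 (_ : logn 2 2 = 1) //; lia.
Qed.

Definition genpoly_fun (R : realType) (K : fieldExtType rat) (f : K -> R) :
    Prop :=
  exists2 F : real_extension R K -> R,
    genpoly F & forall x, f x = F (extend_real R x).

Section GenpolyFun.

Context {R : realType} {K : fieldExtType rat}.
Implicit Types f g : K -> R.
Local Notation genpoly_fun := (@genpoly_fun R K).

Lemma genpoly_fun_ext f g : f =1 g -> genpoly_fun f -> genpoly_fun g.
Proof. by move=> fg [F gF fF]; exists F => // x; rewrite -fg. Qed.

Lemma genpoly_fun_cst (c : R) : genpoly_fun (fun _ : K => c).
Proof. by exists (fun _ => c) => //; exact: genpoly_cst. Qed.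

(** Rational linear functionals extend to real linear functionals on the tensor
    product; this is the source of all nonconstant functions below. *)
Lemma genpoly_fun_additive (f : {additive K -> R}) : genpoly_fun f.
Proof.
have [g gf _] := @extend_realP R K R^o f.
by exists g => [|x]; [exact: genpoly_linear | rewrite gf].
Qed.

Lemma genpoly_funD f g :
  genpoly_fun f -> genpoly_fun g -> genpoly_fun (fun x => f x + g x).
Proof.
move=> [F gF fF] [G gG fG]; exists (fun v => F v + G v).
  exact: genpoly_add.
by move=> x; rewrite fF fG.
Qed.

Lemma genpoly_funM f g :
  genpoly_fun f -> genpoly_fun g -> genpoly_fun (fun x => f x * g x).
Proof.
move=> [F gF fF] [G gG fG]; exists (fun v => F v * G v).
  exact: genpoly_mul.
by move=> x; rewrite fF fG.
Qed.

Lemma genpoly_fun_floor f :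
  genpoly_fun f -> genpoly_fun (fun x => (Num.floor (f x))%:~R).
Proof.
move=> [F gF fF]; exists (fun v => (Num.floor (F v))%:~R).
  exact: genpoly_floor.
by move=> x; rewrite fF.
Qed.

Lemma genpoly_funN f : genpoly_fun f -> genpoly_fun (fun x => - f x).
Proof.
move=> gf; apply: (@genpoly_fun_ext (fun x => -1 * f x)) => [x|].
  by rewrite mulN1r.
exact: (genpoly_funM (genpoly_fun_cst _)).
Qed.

Lemma genpoly_funB f g :
  genpoly_fun f -> genpoly_fun g -> genpoly_fun (fun x => f x - g x).
Proof. by move=> gf gg; apply: genpoly_funD => //; exact: genpoly_funN. Qed.

Lemma genpoly_funX f n : genpoly_fun f -> genpoly_fun (fun x => f x ^+ n).
Proof.
move=> gf; elim: n => [|n IH]; first exact: genpoly_fun_cst.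
apply: (genpoly_fun_ext _ (genpoly_funM gf IH)).
by move=> x; rewrite exprS.
Qed.

Lemma genpoly_fun_sum (J : Type) (r : seq J) (P : pred J) (f : J -> K -> R) :
  (forall j, genpoly_fun (f j)) ->
  genpoly_fun (fun x => \sum_(j <- r | P j) f j x).
Proof.
move=> gf; elim: r => [|j r IH].
  by apply: (genpoly_fun_ext _ (genpoly_fun_cst (0 : R))) => x; rewrite big_nil.
case Pj : (P j); last first.
  by apply: (genpoly_fun_ext _ IH) => x; rewrite big_cons Pj.
apply: (genpoly_fun_ext _ (genpoly_funD (gf j) IH)) => x.
by rewrite big_cons Pj.
Qed.

Lemma genpoly_fun_prod (J : Type) (r : seq J) (P : pred J) (f : J -> K -> R) :
  (forall j, genpoly_fun (f j)) ->
  genpoly_fun (fun x => \prod_(j <- r | P j) f j x).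
Proof.
move=> gf; elim: r => [|j r IH].
  by apply: (genpoly_fun_ext _ (genpoly_fun_cst (1 : R))) => x; rewrite big_nil.
case Pj : (P j); last first.
  by apply: (genpoly_fun_ext _ IH) => x; rewrite big_cons Pj.
apply: (genpoly_fun_ext _ (genpoly_funM (gf j) IH)) => x.
by rewrite big_cons Pj.
Qed.

Lemma genpoly_fun_det n (M : K -> 'M[R]_n) :
  (forall i j, genpoly_fun (fun x => M x i j)) ->
  genpoly_fun (fun x => \det (M x)).
Proof.
move=> gM; apply: genpoly_fun_sum => s; apply: genpoly_funM.
  exact: genpoly_fun_cst.
exact: genpoly_fun_prod.
Qed.

Lemma genpoly_fun_digit_test (c g : R) (L : nat) f :
  genpoly_fun f -> genpoly_fun (fun x => digit_test c g L (f x)).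
Proof.
move=> gf; rewrite /digit_test.
have gL : genpoly_fun (fun x => c * f x ^+ L).
  by apply: genpoly_funM; [exact: genpoly_fun_cst | exact: genpoly_funX].
apply: genpoly_funB; last first.
  apply: genpoly_fun_floor.
  by apply: genpoly_funD; last exact: genpoly_fun_cst.
apply: genpoly_funD; first exact: genpoly_fun_cst.
apply: genpoly_fun_floor.
by apply: genpoly_funB; last exact: genpoly_fun_cst.
Qed.

Lemma floor_eq0 (t : R) : (Num.floor t == 0) = (0 <= t < 1).
Proof. by rewrite floor_eq add0r. Qed.

(** [1] minus the fractional part lies in ]0, 1], and its floor is [1] exactly
    when the fractional part vanishes. *)
Lemma genpoly_fun_is_int f :
  genpoly_fun f -> genpoly_fun (fun x => (f x \is a Num.int)%:R).
Proof.
move=> gf.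
have gfrac : genpoly_fun (fun x => 1 - (f x - (Num.floor (f x))%:~R)).
  apply: genpoly_funB; first exact: genpoly_fun_cst.
  by apply: genpoly_funB => //; exact: genpoly_fun_floor.
apply: (genpoly_fun_ext _ (genpoly_fun_floor gfrac)) => x /=.
rewrite intrEfloor.
have [E|E] := eqVneq (Num.floor (f x))%:~R (f x).
  by rewrite E subrr subr0 floor1.
have l1 := floor_le_tmp (f x); have l2 := floorD1_gt (f x).
have l3 : (Num.floor (f x))%:~R < f x by rewrite lt_neqAle E l1.
rewrite intrD in l2.
rewrite [Num.floor (1 - _)](_ : _ = 0) //.
by apply/eqP; rewrite floor_eq0; apply/andP; split; lra.
Qed.

(** Zero is the only number [t] such that [t] and [t * sqrt 2] are both
    integers. *)
Lemma genpoly_fun_eq0 (f : K -> R) :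
  genpoly_fun f -> genpoly_fun (fun x => (f x == 0)%R%:R).
Proof.
move=> gf; have gg : genpoly_fun (fun x => f x * Num.sqrt 2).
  by apply: genpoly_funM => //; exact: genpoly_fun_cst.
apply: (genpoly_fun_ext _ (genpoly_funM (genpoly_fun_is_int gf)
  (genpoly_fun_is_int gg))) => x /=.
rewrite -natrM mulnb; congr (nat_of_bool _)%:R.
apply/andP/eqP => [[/intrP [m fm] /intrP [n]]|->]; last first.
  by rewrite mul0r !rpred0.
by rewrite fm => /sqrt2_irrational ->.
Qed.

(** The interval ]-1, 1[ is the union of the zero sets of the floors of [f] and
    of [- f]; inclusion and exclusion gives its indicator function. *)
Lemma genpoly_fun_ge1_norm (f : K -> R) :
  genpoly_fun f -> genpoly_fun (fun x => (1 <= `|f x|)%R%:R).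
Proof.
move=> gf.
have g1 := genpoly_fun_eq0 (genpoly_fun_floor gf).
have g2 := genpoly_fun_eq0 (genpoly_fun_floor (genpoly_funN gf)).
have g3 := genpoly_funM g1 g2.
apply: (genpoly_fun_ext _ (genpoly_funD (genpoly_funB (genpoly_funB
  (genpoly_fun_cst (1 : R)) g1) g2) g3)) => x /=.
rewrite !intr_eq0 !floor_eq0 [1 <= _]leNgt ltr_norml /=.
rewrite oppr_ge0 ltrNl.
case: (ltrP (f x) 1) => /= h1; case: (ltrP (-1 : R) (f x)) => /= h2;
 case: (ltrP (0 : R) (f x)) => /= h3;
 case: (lerP (0 : R) (f x)) => /= h4; try lra.
Qed.

End GenpolyFun.

(** * The minimal polynomial of an integral generator *)

Section IntegralGenerator.

Context {K : fieldExtType rat} (b : K).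

Local Notation ZtoQ := (map_poly (intr : int -> rat)).

Lemma horner_alg_eq0 : exists2 q : {poly rat},
    q \is monic /\ separable_poly q &
    forall P, (horner_alg b P == 0) = (q %| P).
Proof.
have [/polyOver1P[q qE] mon rt] :=
  And3 (minPolyOver 1 b) (monic_minPoly 1 b) (root_minPoly 1 b).
have qm : q \is monic by rewrite -(map_monic (in_alg K)) -qE.
exists q.
  have K0 : [pchar K] =i pred0 by move=> n; rewrite pchar_lalg pchar_num.
  have := pcharf0_separable 1%AS K0 b.
  by rewrite /separable_element qE separable_map.
move=> P; apply/idP/idP => [/eqP P0|/dvdpP[Q ->]].
  rewrite -(dvdp_map (in_alg K)) -qE; apply: minPoly_dvdp.
    exact: alg_polyOver.
  exact/rootP.
rewrite rmorphM /= [X in _ * X](_ : _ = 0) ?mulr0 //.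
by move: rt; rewrite qE => /rootP.
Qed.

(** Gauss's lemma: the minimal polynomial divides a monic integral polynomial,
    so up to a sign it is the primitive integral factor of the latter. *)
Lemma integral_minimal_polynomial :
  integralOver (intr : int -> K) b ->
  exists2 p : {poly int}, p \is monic /\ separable_poly (ZtoQ p) &
    forall P, (horner_alg b P == 0) = (ZtoQ p %| P).
Proof.
move=> [s smon sb]; have [q [qmon qsep] qker] := horner_alg_eq0.
have : q %| ZtoQ s.
  rewrite -qker; apply/eqP; rewrite -[RHS](rootP sb) /horner_alg.
  rewrite /horner_morph -map_poly_comp; congr (_.[b]).
  by apply: eq_map_poly => z /=; rewrite scaler_int.
move=> /dvdpP_rat_int [p [a a0 qE] [r sE]].
have lp : lead_coef p \is a GRing.unit.
  have : lead_coef p * lead_coef r = 1 by rewrite -lead_coefM -sE (monicP smon).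
  by move=> lpr; apply/unitrP; exists (lead_coef r); rewrite mulrC lpr.
pose p' := lead_coef p *: p.
have l2 : lead_coef p * lead_coef p = 1.
  by move: lp; rewrite qualifE /= => /orP[] /eqP ->.
have p'mon : p' \is monic by rewrite monicE lead_coefZ l2.
have p'E : ZtoQ p' = q.
  have p'm : ZtoQ p' \is monic by exact: monic_map.
  apply/eqP; rewrite -eqp_monic // /p' qE.
  rewrite linearZ /=.
  apply: (eqp_trans (eqp_scale _ _)).
    by rewrite intr_eq0; apply: contraTneq lp => ->; rewrite unitr0.
  by rewrite eqp_sym eqp_scale.
by exists p' => //; rewrite p'E.
Qed.

End IntegralGenerator.

(** * Coordinates in the power basis, and the order Z[b] *)

Section PowerBasis.

Context {K : fieldExtType rat} (b : K) (p : {poly int}).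
Local Notation ZtoQ := (map_poly (intr : int -> rat)).
Local Notation ev := (horner_alg b).
Local Notation pQ := (ZtoQ p).
Local Notation d := (size p).-1.

Hypothesis p_monic : p \is monic.
Hypothesis p_ker : forall P, (ev P == 0) = (pQ %| P).
Hypothesis b_gen : forall x, exists P, x = ev P.

Let pQ_monic : pQ \is monic. Proof. exact: monic_map. Qed.
Let pQ_neq0 : pQ != 0. Proof. exact: monic_neq0. Qed.
Let size_pQ : size pQ = size p.
Proof. by rewrite size_map_poly_id0 // intr_eq0 lead_coef_eq0 monic_neq0. Qed.
Let size_pE : size p = d.+1.
Proof. by rewrite prednK // lt0n size_poly_eq0 monic_neq0. Qed.

Lemma degree_gt0 : (0 < d)%N.
Proof.
have : ~~ (pQ %| 1) by rewrite -p_ker rmorph1 oner_eq0.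
rewrite dvdp1 size_pQ size_pE; by case: d.
Qed.

(** The coefficients of this polynomial are the coordinates of [x] in the power
    basis [1, b, b^2, ...]. *)
Definition power_rep (x : K) : {poly rat} := projT1 (cid (b_gen x)) %% pQ.

Lemma power_repE P : power_rep (ev P) = P %% pQ.
Proof.
rewrite /power_rep; case: cid => Q /= /eqP.
rewrite -subr_eq0 -rmorphB p_ker => /modp_eq0P.
by rewrite modpD modpN => /eqP; rewrite subr_eq0 => /eqP.
Qed.

Lemma ev_modp P : ev (P %% pQ) = ev P.
Proof.
apply/eqP; rewrite -subr_eq0 -rmorphB p_ker.
by apply/modp_eq0P; rewrite modpD modpN modp_id subrr.
Qed.

Lemma ev_power_rep x : ev (power_rep x) = x.
Proof. by have [P ->] := b_gen x; rewrite power_repE ev_modp. Qed.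

Lemma size_power_rep x : (size (power_rep x) <= d)%N.
Proof. by rewrite -ltnS -size_pE -size_pQ ltn_modp. Qed.

Lemma power_repD x y : power_rep (x + y) = power_rep x + power_rep y.
Proof.
have [[P ->] [Q ->]] := (b_gen x, b_gen y).
by rewrite -rmorphD !power_repE modpD.
Qed.

Lemma power_expansion x : x = \sum_(k < d) (power_rep x)`_k *: b ^+ k.
Proof.
rewrite -{1}[x]ev_power_rep.
rewrite [LHS](@horner_coef_wide _ d); last first.
  by rewrite size_map_poly size_power_rep.
by apply: eq_bigr => i _; rewrite coef_map /= mulr_algl.
Qed.

Definition in_order (x : K) : Prop := exists P : {poly int}, x = ev (ZtoQ P).

Lemma in_orderM x y : in_order x -> in_order y -> in_order (x * y).
Proof. by move=> [P ->] [Q ->]; exists (P * Q); rewrite !rmorphM. Qed.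

Lemma in_orderX x n : in_order x -> in_order (x ^+ n).
Proof. by move=> [P ->]; exists (P ^+ n); rewrite !rmorphXn. Qed.

Lemma in_order_gen : in_order b.
Proof. by exists 'X; rewrite map_polyX /= horner_algX. Qed.

(** The remainder of an integral polynomial modulo a monic integral polynomial
    is integral, so [Z[b]] is the lattice spanned by the power basis. *)
Lemma in_order_coef x :
  in_order x <-> forall k : 'I_d, (power_rep x)`_k \is a Num.int.
Proof.
split=> [[P ->] k | h].
  rewrite power_repE [ZtoQ P](_ : _ =
    ZtoQ (Pdiv.Ring.rdivp P p) * pQ + ZtoQ (Pdiv.Ring.rmodp P p)).
    rewrite modp_addl_mul_small ?coef_map //=.
    rewrite size_pQ (leq_ltn_trans (size_poly _ _)) //.
    by rewrite Pdiv.Ring.ltn_rmodp monic_neq0.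
  by rewrite -rmorphM -rmorphD /= -Pdiv.RingMonic.rdivp_eq.
have /floorpP [P PE] : power_rep x \is a polyOver Num.int.
  apply/polyOverP => k; have [kd|kd] := ltnP k d; first exact: (h (Ordinal kd)).
  by rewrite nth_default ?rpred0 // (leq_trans (size_power_rep x)).
by exists P; rewrite -PE ev_power_rep.
Qed.

Lemma in_order_integral x :
  integralOver (intr : int -> K) b -> in_order x ->
  integralOver (intr : int -> K) x.
Proof.
move=> bi [P ->]; rewrite /horner_alg /horner_morph.
apply: integral_horner => //.
apply/integral_poly => i; rewrite !coef_map /= scaler_int.
exact: integral_id.
Qed.

Definition mult_mx (x : K) : 'M[rat]_d :=
  \matrix_(i < d, k < d) (power_rep (b ^+ i * x))`_k.

Lemma mult_mx_int x : in_order x ->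
  exists A : 'M[int]_d, mult_mx x = map_mx intr A.
Proof.
move=> xo; exists (\matrix_(i, k) Num.floor (mult_mx x i k)).
apply/matrixP => i k; rewrite !mxE floorK //.
apply: (in_order_coef _).1; apply: in_orderM => //; apply: in_orderX.
exact: in_order_gen.
Qed.

(** The inverse comes from the adjugate: if [A] is the integral matrix of the
    multiplication by [x], the first row [v] of [\det A *: \adj A] satisfies
    [v *m A = (1, 0, ..., 0)], so it lists the coordinates of the inverse
    of [x]. *)
Lemma in_order_inv x : in_order x -> \det (mult_mx x) ^+ 2 = 1 ->
  x != 0 /\ in_order x^-1.
Proof.
move=> xo; have [A AE] := mult_mx_int xo; rewrite AE det_map_mx -rmorphXn /=.
move=> /(@intr_inj rat _ 1) detA.
pose i0 := Ordinal degree_gt0.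
pose v := \det A *: row i0 (\adj A).
have vA : v *m A = delta_mx 0 i0.
  rewrite -scalemxAl -row_mul mul_adj_mx; apply/rowP => k; rewrite !mxE.
  by rewrite mulrnAr -expr2 detA eqxx eq_sym.
pose y := \sum_(k < d) (v 0 k)%:~R *: b ^+ k.
have yo : in_order y.
  exists (\sum_(k < d) (v 0 k) *: 'X^k); rewrite !rmorph_sum /=.
  apply: eq_bigr => k _.
  rewrite map_polyZ /= map_polyXn linearZ /= rmorphXn /= horner_algX.
  by rewrite mulr_algl.
have yx : y * x = 1.
  transitivity (\sum_(l < d) ((v *m A) 0 l)%:~R *: b ^+ l).
    rewrite mulr_suml.
    transitivity (\sum_(k < d) \sum_(l < d)
        (v 0 k)%:~R *: ((power_rep (b ^+ k * x))`_l *: b ^+ l)).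
      apply: eq_bigr => k _; rewrite -scalerAl -scaler_sumr.
      by rewrite -power_expansion.
    rewrite exchange_big /=; apply: eq_bigr => l _.
    rewrite mxE rmorph_sum /= scaler_suml; apply: eq_bigr => k _.
    have := congr1 (fun B : 'M_d => B k l) AE; rewrite !mxE => ->.
    by rewrite scalerA -rmorphM.
  rewrite vA (bigD1 i0) //= big1 ?addr0.
    by rewrite mxE !eqxx expr0 scale1r.
  by move=> l /negPf l0; rewrite mxE l0 andbF scale0r.
have x0 : x != 0.
  by apply/eqP => x0; move/eqP: yx; rewrite x0 mulr0 eq_sym oner_eq0.
split=> //; suff -> : x^-1 = y by [].
by apply: (mulIf x0); rewrite mulVf.
Qed.

(** * Embeddings into the complex numbers *)

Section Conjugates.

Context {R : realType}.
Local Notation C := (R[i])%C.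

Hypothesis p_sep : separable_poly pQ.

Lemma norm_real_complex (y : R) : `|y%:C%C| = `|y|%:C%C :> C.
Proof. by rewrite normc_def /= expr0n addr0 sqrtr_sqr. Qed.

(** For a complex root [a] of the minimal polynomial, this is the field
    embedding that maps [b] to [a]. *)
Definition embed (a : C) (x : K) : C := (map_poly ratr (power_rep x)).[a].

Lemma embed_ev a P : root (map_poly ratr pQ) a ->
  embed a (ev P) = (map_poly ratr P).[a].
Proof.
move=> /rootP ra; rewrite /embed power_repE {2}(divp_eq P pQ).
by rewrite rmorphD rmorphM /= hornerD hornerM ra mulr0 add0r.
Qed.

Lemma embedM a x y : root (map_poly ratr pQ) a ->
  embed a (x * y) = embed a x * embed a y.
Proof.
move=> ra; have [[P ->] [Q ->]] := (b_gen x, b_gen y).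
by rewrite -rmorphM !embed_ev // rmorphM hornerM.
Qed.

Lemma embed1 a : root (map_poly ratr pQ) a -> embed a 1 = 1.
Proof. by move=> ra; rewrite -(rmorph1 ev) embed_ev // rmorph1 hornerC. Qed.

Lemma embedX a x n : root (map_poly ratr pQ) a ->
  embed a (x ^+ n) = embed a x ^+ n.
Proof.
move=> ra; elim: n => [|n IH]; first by rewrite embed1.
by rewrite !exprS embedM // IH.
Qed.

Lemma embed_gen a : root (map_poly ratr pQ) a -> embed a b = a.
Proof.
by move=> ra; rewrite -{1}(horner_algX b) embed_ev // map_polyX hornerX.
Qed.

Lemma embed_real (sigma : {rmorphism K -> R}) x :
  embed (sigma b)%:C%C x = (sigma x)%:C%C.
Proof.
rewrite -{2}[x]ev_power_rep /embed.
elim/poly_ind: (power_rep x) => [|P c IH]; first by rewrite !rmorph0 horner0.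
rewrite !rmorphD !rmorphM /= map_polyX map_polyC hornerMXaddC IH.
rewrite horner_algX horner_algC; congr (_ + _).
exact: esym (fmorph_eq_rat (real_complex R \o sigma \o in_alg K) c).
Qed.

Lemma root_gen (sigma : {rmorphism K -> R}) :
  root (map_poly ratr pQ) (sigma b)%:C%C.
Proof.
have e0 : embed (sigma b)%:C%C 0 = 0 by rewrite embed_real rmorph0.
have ep : ev pQ = 0 by apply/eqP; rewrite p_ker.
have : (map_poly (real_complex R \o sigma \o in_alg K) pQ).[(sigma b)%:C%C] = 0.
  rewrite !map_poly_comp -[X in _.[X]]/(real_complex R (sigma b)).
  rewrite !horner_map /=.
  by rewrite -[_.[b]]/(ev pQ) ep !rmorph0.
rewrite rootE => E; rewrite -E; apply/eqP; congr (_.[_]).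
apply: eq_map_poly => q.
exact: esym (fmorph_eq_rat (real_complex R \o sigma \o in_alg K) q).
Qed.

(** The roots are distinct since the characteristic is zero; this makes the
    Vandermonde matrix below invertible. *)
Lemma exists_roots : { rs : d.-tuple C | uniq rs /\
  map_poly ratr pQ = \prod_(a <- rs) ('X - a%:P) }.
Proof.
have [rs E] := closed_field_poly_normal (map_poly ratr pQ : {poly C}).
have lc : lead_coef (map_poly ratr pQ : {poly C}) = 1.
  by apply/monicP; rewrite map_monic.
rewrite lc scale1r in E.
have srs : size rs == d.
  have := congr1 (fun q : {poly C} => (size q).-1) E.
  by rewrite size_prod_XsubC size_map_poly size_pQ => /= ->.
exists (Tuple srs); split=> //=.
by rewrite -separable_prod_XsubC -E separable_map.
Qed.

Definition conj_roots : d.-tuple C := projT1 exists_roots.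

Lemma conj_rootsP a : (a \in conj_roots) = root (map_poly ratr pQ) a.
Proof.
rewrite /conj_roots; case: exists_roots => rs [_ E] /=.
by rewrite E root_prod_XsubC.
Qed.

Lemma conj_roots_uniq : uniq conj_roots.
Proof. by rewrite /conj_roots; case: exists_roots => rs []. Qed.

Let vdm : 'M[C]_d := Vandermonde d (\row_j tnth conj_roots j).

Let vdm_unit : vdm \in unitmx.
Proof.
rewrite unitmxE det_Vandermonde unitfE.
apply/prodf_neq0 => i _; apply/prodf_neq0 => j ij.
rewrite !mxE subr_eq0.
apply: contraTneq ij => /tuple_uniqP -/(_ conj_roots_uniq) ->.
by rewrite ltnn.
Qed.

Let embed_row x :
  (\row_k ratr (power_rep x)`_k) *m vdm = \row_j embed (tnth conj_roots j) x.
Proof.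
apply/rowP => j; rewrite !mxE /embed (@horner_coef_wide _ d).
  by apply: eq_bigr => k _; rewrite !mxE coef_map.
by rewrite size_map_poly size_power_rep.
Qed.

(** The Vandermonde matrix of the conjugates of [b] diagonalises all the
    multiplication matrices at once, hence the formulas for the determinant and
    the trace. *)
Let mult_mx_vdm x :
  map_mx ratr (mult_mx x) *m vdm =
  vdm *m diag_mx (\row_j embed (tnth conj_roots j) x).
Proof.
apply/row_matrixP => i; rewrite row_mul.
have -> : row i (map_mx ratr (mult_mx x)) =
    \row_k (ratr (power_rep (b ^+ i * x))`_k : C).
  by apply/rowP => k; rewrite !mxE.
rewrite embed_row; apply/rowP => j; rewrite mul_mx_diag !mxE.
have rj : root (map_poly ratr pQ) (tnth conj_roots j).
  by rewrite -conj_rootsP mem_tnth.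
by rewrite embedM // embedX // embed_gen.
Qed.

Lemma det_mult_mx x :
  ratr (\det (mult_mx x)) = \prod_(j < d) embed (tnth conj_roots j) x.
Proof.
have := congr1 determinant (mult_mx_vdm x).
rewrite !det_mulmx mulrC => /mulfI.
rewrite -unitfE -unitmxE vdm_unit => /(_ isT).
rewrite det_map_mx det_diag => ->.
by apply: eq_bigr => j _; rewrite mxE.
Qed.

Lemma trace_mult_mx x :
  ratr (\tr (mult_mx x)) = \sum_(j < d) embed (tnth conj_roots j) x.
Proof.
have E : map_mx ratr (mult_mx x) =
    vdm *m diag_mx (\row_j embed (tnth conj_roots j) x) *m invmx vdm.
  by rewrite -mult_mx_vdm mulmxK.
rewrite -trace_map_mx E mxtrace_mulC mulKmx // mxtrace_diag.
by apply: eq_bigr => j _; rewrite mxE.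
Qed.

(** The coordinates of [x] are obtained from its conjugates by a fixed matrix,
    the inverse of the Vandermonde matrix. For elements of [Z[b]] this is the
    finiteness of the set of algebraic integers with bounded conjugates. *)
Lemma power_rep_bounded (M : R) :
  exists N : nat, forall x,
   (forall a, root (map_poly ratr pQ) a -> `|embed a x| <= M%:C%C) ->
   forall k : 'I_d, `|(power_rep x)`_k| <= N%:R.
Proof.
pose W := \sum_j \sum_(k < d) `|invmx vdm j k| : C.
have W0 : 0 <= W by rewrite !sumr_ge0 // => i _; rewrite sumr_ge0.
exists (Num.bound (complex.Re (M%:C%C * W))) => x hx k.
have rE : ratr (power_rep x)`_k =
    \sum_j embed (tnth conj_roots j) x * invmx vdm j k.
  have := congr1 (mulmxr (invmx vdm)) (embed_row x) => /=.
  rewrite mulmxK // => /rowP/(_ k); rewrite !mxE => ->.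
  by apply: eq_bigr => j _; rewrite mxE.
have h : `|ratr (power_rep x)`_k : C| <= M%:C%C * W.
  rewrite rE mulr_sumr (le_trans (ler_norm_sum _ _ _)) // ler_sum // => j _.
  rewrite normrM; apply: ler_pM => //.
    by apply: hx; rewrite -conj_rootsP mem_tnth.
  by rewrite (bigD1 k) //= lerDl sumr_ge0.
have rC : ratr (power_rep x)`_k = (ratr (power_rep x)`_k)%:C%C :> C.
  by rewrite -(fmorph_eq_rat (real_complex R \o ratr)).
move: h; rewrite rC norm_real_complex lecE => /andP[_ /= h].
rewrite -(ler_rat R) ratr_norm ratr_nat (le_trans h) // ltW //.
by apply: archi_boundP; apply: le_trans h.
Qed.

(** * Pisot units *)

Section Pisot.

Context (sigma : {rmorphism K -> R}).
Local Notation beta := (sigma b).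

Hypothesis beta_gt1 : 1 < beta.
Hypothesis beta_pisot : forall a : C,
  root (map_poly ratr pQ) a -> a != beta%:C%C -> `|a| < 1.

(** The trace of [b ^+ m] is the sum of the [m]-th powers of the conjugates, all
    of which but [beta ^+ m] decay geometrically. *)
Lemma pisot_trace : exists (u : nat -> int) (M rho : R),
  0 <= rho < 1 /\ forall m, `|(u m)%:~R - beta ^+ m| <= M * rho ^+ m.
Proof.
have /tnthP [j0 j0E] : beta%:C%C \in conj_roots by rewrite conj_rootsP root_gen.
pose n (a : C) : R := complex.Re `|a|.
have nE a : `|a| = (n a)%:C%C by rewrite /n normc_def.
pose rho := \big[Num.max/0]_(j < d | j != j0) n (tnth conj_roots j).
have rj j : root (map_poly ratr pQ) (tnth conj_roots j).
  by rewrite -conj_rootsP mem_tnth.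
have rho1 : rho < 1.
  apply: bigmax_lt => // j jj0; rewrite -ltcR -nE beta_pisot //.
  rewrite j0E; apply: contra_neq jj0; apply: tuple_uniqP.
  exact: conj_roots_uniq.
have rhoj j : j != j0 -> n (tnth conj_roots j) <= rho.
  by move=> jj0; exact: le_bigmax_cond.
exists (fun m => Num.floor (\tr (mult_mx (b ^+ m)))), d%:R, rho.
split; first by rewrite rho1 bigmax_ge_id.
move=> m; rewrite -lecR.
have uE : (Num.floor (\tr (mult_mx (b ^+ m))))%:~R%:C%C =
   \sum_(j < d) tnth conj_roots j ^+ m :> C.
  have bo : in_order (b ^+ m) by apply: in_orderX; exact: in_order_gen.
  have [A AE] := mult_mx_int bo.
  transitivity (ratr (\tr (mult_mx (b ^+ m))) : C).
    by rewrite AE trace_map_mx /= ratr_int intrKfloor rmorph_int.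
  rewrite trace_mult_mx; apply: eq_bigr => j _.
  by rewrite embedX // embed_gen.
rewrite -norm_real_complex rmorphB rmorphXn /= uE (bigD1 j0) //=.
rewrite j0E addrAC subrr add0r.
apply: (le_trans (ler_norm_sum _ _ _)).
apply: (@le_trans _ _ (\sum_(j < d) (rho ^+ m)%:C%C)); last first.
  by rewrite sumr_const card_ord mulr_natl rmorphMn.
rewrite [leRHS](bigD1 j0) //= -[leLHS]add0r lerD //.
  by rewrite lecR exprn_ge0 // bigmax_ge_id.
apply: ler_sum => j jj0; rewrite normrX nE -rmorphXn lecR.
rewrite lerXn2r ?rhoj ?nnegrE ?bigmax_ge_id //.
by rewrite -ler0c -nE.
Qed.

Definition order_unit x := [/\ x != 0, in_order x & in_order x^-1].

Hypothesis b_inv : in_order b^-1.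

Hypothesis unit_dep : forall x, order_unit x ->
  exists s t : int, (s != 0) || (t != 0) /\ x ^ s * b ^ t = 1.

Let b0 : b != 0.
Proof. by apply: contraTneq beta_gt1 => ->; rewrite rmorph0 ltr10. Qed.

Let beta0 : 0 < beta. Proof. exact: lt_trans ltr01 beta_gt1. Qed.

Lemma order_unit_gen : order_unit b.
Proof. by split=> //; exact: in_order_gen. Qed.

Lemma order_unitM x y : order_unit x -> order_unit y -> order_unit (x * y).
Proof.
move=> [x0 x1 x2] [y0 y1 y2]; split; first by rewrite mulf_neq0.
  exact: in_orderM.
by rewrite invfM; exact: in_orderM.
Qed.

Lemma order_unitX x n : order_unit x -> order_unit (x ^+ n).
Proof.
move=> [x0 x1 x2]; split; first by rewrite expf_neq0.
  exact: in_orderX.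
by rewrite -exprVn; exact: in_orderX.
Qed.

Lemma order_unitV x : order_unit x -> order_unit x^-1.
Proof. by move=> [x0 x1 x2]; split; rewrite ?invr_eq0 ?invrK. Qed.

Lemma order_unit_det x :
  order_unit x <-> in_order x /\ \det (mult_mx x) ^+ 2 = 1.
Proof.
split=> [[x0 x1 x2] | [x1 dx]]; last first.
  by have [x0 x2] := in_order_inv x1 dx.
split=> //; have [[A AE] [B BE]] := (mult_mx_int x1, mult_mx_int x2).
have : ratr (\det (mult_mx x) * \det (mult_mx x^-1)) = 1 :> C.
  rewrite rmorphM /= !det_mult_mx -big_split /= big1 // => j _.
  have rj : root (map_poly ratr pQ) (tnth conj_roots j).
    by rewrite -conj_rootsP mem_tnth.
  by rewrite -embedM // mulfV // embed1.
rewrite AE BE !det_map_mx -rmorphM /= ratr_int => /(@intr_inj C _ 1) AB.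
rewrite -rmorphXn /=.
have : \det A \is a GRing.unit by apply/unitrP; exists (\det B); rewrite mulrC.
by rewrite qualifE /= => /orP[] /eqP ->.
Qed.

(** A relation [x ^ s * b ^ t = 1] with [s] and [t] of the same sign contradicts
    [1 <= |sigma x|] and [1 < beta], except when [t = 0]. *)
Lemma order_unit_power x : order_unit x -> 1 <= `|sigma x| ->
  exists n m, (0 < n)%N /\ x ^+ n = b ^+ m.
Proof.
move=> xu x1; have [x0 _ _] := xu; have [s [t [st]]] := unit_dep xu.
have big n m : x ^+ n * b ^+ m = 1 -> m = 0%N.
  move=> /(congr1 (fun y => `|sigma y|)).
  rewrite rmorphM rmorphXn rmorphXn rmorph1 normrM !normrX normr1.
  rewrite (gtr0_norm beta0) => E; apply/eqP; apply/negPn/negP => m0.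
  have h1 : 1 <= `|sigma x| ^+ n by rewrite exprn_ege1.
  have h2 : 1 < beta ^+ m by rewrite exprn_egt1.
  have h3 : `|sigma x| ^+ n * beta ^+ m > 1 by nra.
  by rewrite E ltxx in h3.
case: s t st => [n|n] [m|m] /= st E.
- have m0 := big _ _ E; exists n, 0%N; split.
    by move: st; rewrite m0 orbF lt0n.
  by move: E; rewrite m0 expr0 mulr1.
- have {}E : x ^+ n / b ^+ m.+1 = 1 := E.
  exists n, m.+1; split; last first.
    by rewrite -[RHS]mul1r -E divfK // expf_neq0.
  rewrite lt0n; apply/eqP => n0; rewrite n0 in E.
  have := big 0%N m.+1; rewrite mul1r => h.
  suff : m.+1 = 0%N by []; apply: h; apply: invr_inj.
  by rewrite invr1 -E mul1r.
- have {}E : x ^- n.+1 * b ^+ m = 1 := E.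
  exists n.+1, m; split=> //.
  by rewrite -[LHS]mulr1 -E mulrA mulfV ?mul1r // expf_neq0.
- have {}E : x ^- n.+1 * b ^- m.+1 = 1 := E.
  suff : m.+1 = 0%N by [].
  by apply: (big n.+1); apply: invr_inj; rewrite invr1 -E invfM.
Qed.

(** An embedding that sends [b] into the unit disc sends [x ^+ n = b ^+ m], and
    therefore [x], into the closed unit disc. *)
Lemma order_unit_embed_le x a : order_unit x -> 1 <= `|sigma x| < beta ->
  root (map_poly ratr pQ) a -> `|embed a x| <= beta%:C%C.
Proof.
move=> xu /andP[x1 x2] ra.
have [->|ab] := eqVneq a beta%:C%C.
  by rewrite embed_real norm_real_complex lecR ltW.
have [n [m [n0 E]]] := order_unit_power xu x1.
apply: (@le_trans _ _ 1); last by rewrite lecR ltW.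
rewrite -(@ler_pXn2r _ n) // ?nnegrE //.
rewrite expr1n -normrX -embedX // E embedX // embed_gen // normrX.
by rewrite exprn_ile1 // ltW // beta_pisot.
Qed.

Lemma exists_exp_bracket (y : R) : 1 <= y ->
  exists n, beta ^+ n <= y < beta ^+ n.+1.
Proof.
move=> y1; have [N hN] := exists_expn_gt y beta_gt1.
have ex : exists n, y < beta ^+ n by exists N; exact: hN.
case: (ex_minnP ex) => -[|n] yn min.
  by move: yn; rewrite expr0 ltNge y1.
by exists n; rewrite yn andbT leNgt; apply/negP => /min; rewrite ltnn.
Qed.

(** The elements [x ^+ i / b ^+ n], with [n] chosen so that the absolute value
    lies between [1] and [beta], take at most [#|T|] values, and [T] does not
    depend on [x]. Two of the first [#|T| + 1] coincide, and this gives a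
    relation [x ^+ e = b ^+ m] with [0 < e <= #|T|]; the factorial is a common
    multiple of all these [e]. *)
Lemma uniform_exponent : exists2 s, (0 < s)%N &
  forall x, order_unit x -> 1 <= `|sigma x| ->
  exists k, sigma x ^+ s = beta ^+ k.
Proof.
have [N NP] := power_rep_bounded beta.
pose T := {ffun 'I_d -> 'I_(2 * N).+1}.
pose code y : T :=
  [ffun k : 'I_d => inord (absz (Num.floor (power_rep y)`_k + N%:Z))].
exists (#|T|)`!; first exact: fact_gt0.
move=> x xu x1.
have nP i : exists n, beta ^+ n <= `|sigma x| ^+ i < beta ^+ n.+1.
  by apply: exists_exp_bracket; rewrite exprn_ege1.
pose n i := projT1 (cid (nP i)).
have nE i : beta ^+ n i <= `|sigma x| ^+ i < beta ^+ (n i).+1.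
  by rewrite /n; case: cid.
pose y i := x ^+ i / b ^+ n i.
have yu i : order_unit (y i).
  apply: order_unitM; first exact: order_unitX.
  by apply/order_unitV/order_unitX; exact: order_unit_gen.
have y1 i : 1 <= `|sigma (y i)| < beta.
  have bn : 0 < beta ^+ n i by rewrite exprn_gt0.
  rewrite /y fmorph_div !rmorphXn normrM normfV !normrX (gtr0_norm beta0).
  by rewrite ler_pdivlMr // ltr_pdivrMr // mul1r -exprS.
have y_int i (k : 'I_d) : (power_rep (y i))`_k \is a Num.int.
  by apply: (in_order_coef _).1; have [] := yu i.
have y_bd i (k : 'I_d) : `|(power_rep (y i))`_k| <= N%:R.
  by apply: NP => a; apply: order_unit_embed_le.
have code_inj i j : code (y i) = code (y j) -> y i = y j.
  move=> E; rewrite -(ev_power_rep (y i)) -(ev_power_rep (y j)); congr (ev _).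
  apply/polyP => k; have [kd|kd] := ltnP k d; last first.
    by rewrite !nth_default // (leq_trans (size_power_rep _)).
  pose k' := Ordinal kd; have := congr1 (fun f : T => nat_of_ord (f k')) E.
  pose z l := Num.floor (power_rep (y l))`_k.
  have bd l : - N%:Z <= z l <= N%:Z.
    have := y_bd l k'; rewrite /= -(floorK (y_int l k')) -intr_norm.
    by rewrite -[N%:R]/(N%:Z%:~R) ler_int ler_norml.
  have bd' l : (absz (z l + N%:Z)%R < (2 * N).+1)%N by have := bd l; lia.
  rewrite !ffunE !inordK ?bd' // => EN.
  have {}EN : absz (z i + N%:Z) = absz (z j + N%:Z) := EN.
  have {EN} : z i = z j by have := bd i; have := bd j; lia.
  move/(congr1 (fun z : int => z%:~R : rat)).
  by rewrite /z (floorK (y_int i k')) (floorK (y_int j k')).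
have /injectivePn [i [j ij /code_inj yij]] :
    ~~ injectiveb (fun i : 'I_#|T|.+1 => code (y i)).
  by apply/negP => /injectiveP/leq_card; rewrite card_ord ltnn.
wlog ltij : i j ij yij / (i < j)%N.
  move=> H; have [lt|lt|/val_inj E] := ltngtP i j; first exact: (H i j).
    by apply: (H j i); rewrite // eq_sym.
  by rewrite E eqxx in ij.
have E : x ^+ (j - i) * b ^+ n i = b ^+ n j.
  have [x0 _ _] := xu; have bn l : b ^+ n l != 0 by rewrite expf_neq0.
  move: yij; rewrite /y -{1}(subnK (ltnW ltij)) exprD.
  move=> /(congr1 (fun z => z * b ^+ n i * b ^+ n j)); rewrite divfK //.
  rewrite mulrAC divfK // [_ * x ^+ i]mulrC -!mulrA.
  by move=> /(mulfI (expf_neq0 _ x0)) ->.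
have Es : sigma x ^+ (j - i) * beta ^+ n i = beta ^+ n j.
  by rewrite -!rmorphXn -rmorphM E.
have nij : (n i <= n j)%N.
  rewrite -(ler_eXn2l beta_gt1) -Es.
  have -> : sigma x ^+ (j - i) * beta ^+ n i =
      `|sigma x| ^+ (j - i) * beta ^+ n i.
    rewrite -[LHS]gtr0_norm; last by rewrite Es exprn_gt0.
    by rewrite normrM !normrX (gtr0_norm beta0).
  by rewrite ler_peMl ?exprn_ge0 ?exprn_ege1 // ltW.
have Ex : sigma x ^+ (j - i) = beta ^+ (n j - n i).
  have bn0 : beta ^+ n i != 0 by rewrite expf_neq0 // gt_eqF.
  by apply: (mulIf bn0); rewrite Es -exprD subnK.
have dv : (j - i %| (#|T|)`!)%N.
  apply: dvdn_fact; rewrite subn_gt0 ltij /=.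
  by rewrite (leq_trans (leq_subr _ _)) // -ltnS.
exists ((n j - n i) * ((#|T|)`! %/ (j - i)))%N.
by rewrite -{1}(divnK dv) mulnC exprM Ex -exprM.
Qed.

Lemma genpoly_order_unit :
  genpoly_fun (fun x : K => (`[< order_unit x >])%:R : R).
Proof.
have gco (k : nat) (f : {additive K -> K}) :
    genpoly_fun (fun x : K => ratr (power_rep (f x))`_k : R).
  pose g x : R := ratr (power_rep (f x))`_k.
  have gD : {morph g : x y / x + y}.
    by move=> x y; rewrite /g raddfD power_repD coefD rmorphD.
  have g0 : g 0 = 0 by apply: (addrI (g 0)); rewrite -gD !addr0.
  have gN : {morph g : x / - x}.
    by move=> x; apply/eqP; rewrite -addr_eq0 -gD addNr g0.
  have gB : additive g by move=> x y; rewrite gD gN.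
  pose gM := GRing.isAdditive.Build _ _ g gB.
  pose gA : {additive K -> R} := HB.pack g gM.
  exact: (genpoly_fun_additive gA).
have g1 : genpoly_fun (fun x : K => \prod_(k < d)
    ((ratr (power_rep x)`_k : R) \is a Num.int)%:R : R).
  apply: genpoly_fun_prod => k; apply: genpoly_fun_is_int.
  exact: (gco k idfun).
have g2 : genpoly_fun (fun x : K =>
    (\det (map_mx ratr (mult_mx x) : 'M[R]_d) ^+ 2 - 1 == 0)%R%:R : R).
  apply: genpoly_fun_eq0; apply: genpoly_funB; last exact: genpoly_fun_cst.
  apply: genpoly_funX; apply: genpoly_fun_det => i k.
  apply: (@genpoly_fun_ext _ _ (fun x => ratr (power_rep (b ^+ i * x))`_k)).
    by move=> x; rewrite !mxE.
  exact: (gco k (b ^+ i \*o idfun)).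
apply: (genpoly_fun_ext _ (genpoly_funM g1 g2)) => x /=.
have ratr_is_int (q : rat) : q \is a Num.int = (ratr q \is a @Num.int R).
  apply/idP/idP => /intrP[m E]; apply/intrP; exists m.
    by rewrite E ratr_int.
  by apply: (fmorph_inj (@ratr R)); rewrite /= E ratr_int.
rewrite det_map_mx subr_eq0 -rmorphXn fmorph_eq1.
under eq_bigr do rewrite -ratr_is_int.
have [xu|xu] := asboolP (order_unit x).
  have [xo ->] := (order_unit_det x).1 xu.
  rewrite eqxx mulr1 big1 // => k _.
  by rewrite ((in_order_coef x).1 xo).
have [dx|] := eqVneq (\det (mult_mx x) ^+ 2) 1; last by rewrite mulr0.
rewrite mulr1.
have [/forallP h|] := boolP [forall k : 'I_d, (power_rep x)`_k \is a Num.int].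
  by case: xu; apply/order_unit_det; split=> //; apply/in_order_coef.
rewrite negb_forall => /existsP[k /negPf hk].
by rewrite (bigD1 k) //= hk mul0r.
Qed.

(** At a unit [x] with [1 <= |sigma x|], where [sigma x ^+ s = beta ^+ k], the
    first test determines whether [k] is in [s * I]. If so, [sigma x] is
    [beta ^+ i] or [- beta ^+ i] with [i] in [I], and the second test decides
    the sign. *)
Lemma genpoly_powers (I : set nat) :
  genpoly_fun (\1_[set b ^+ i | i in I] : K -> R).
Proof.
have [s s0 sP] := uniform_exponent.
have [u [M [rho [rho01 uP]]]] := pisot_trace.
have [c [g [L test]]] := exists_digit_test
  (fun k => `[< exists2 i, I i & k = (s * i)%N >]) beta_gt1 rho01 uP.
have [c' [g' [L' test']]] := exists_digit_test xpredT beta_gt1 rho01 uP.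
have gs := genpoly_fun_additive sigma.
apply: (genpoly_fun_ext _ (genpoly_funM (genpoly_funM genpoly_order_unit
  (genpoly_fun_ge1_norm gs)) (genpoly_funM
  (genpoly_fun_digit_test c g L (genpoly_funX s gs))
  (genpoly_fun_digit_test c' g' L' gs)))) => x /=.
rewrite indicE; have [[i Ii <-]|xI] := asboolP ([set b ^+ i | i in I] x).
  rewrite mem_set; last by exists i.
  have bu : order_unit (b ^+ i) by apply: order_unitX; exact: order_unit_gen.
  rewrite asboolT // rmorphXn normrX (gtr0_norm beta0) exprn_ege1 ?ltW //.
  rewrite (test' i).1 -exprM (test _).1 asboolT ?mulr1 //.
  by exists i; rewrite // mulnC.
rewrite memNset //.
have [xu|] := asboolP (order_unit x); last by rewrite !mul0r.
have [x1|] := boolP (1 <= `|sigma x|); last by rewrite mulr0 mul0r.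
have [k kE] := sP _ xu x1.
rewrite kE (test k).1.
have [[i Ii ki]|] := asboolP; last by rewrite mul0r mulr0.
have xE : `|sigma x| = beta ^+ i.
  apply/eqP; rewrite -(eqrXn2 s0 (normr_ge0 _) (ltW (exprn_gt0 i beta0))).
  rewrite -exprM mulnC -ki -kE.
  by rewrite -normrX kE gtr0_norm ?exprn_gt0.
have [x0|x0] := lerP 0 (sigma x).
  case: xI; exists i => //; apply: (fmorph_inj sigma).
  by rewrite rmorphXn -xE ger0_norm.
have -> : sigma x = - beta ^+ i by rewrite -xE ltr0_norm // opprK.
by rewrite (test' i).2 !mulr0.
Qed.

End Pisot.
End Conjugates.
End PowerBasis.

(** * The theorem *)

Lemma integralOver_fmorph (F E : fieldType) (f : {rmorphism F -> E}) (x : F) :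
  integralOver (intr : int -> E) (f x) -> integralOver (intr : int -> F) x.
Proof.
move=> [q qmon qx]; exists q => //; rewrite -(fmorph_root f) -map_poly_comp.
by move: qx; congr (root _ _); apply: eq_map_poly => z /=; rewrite rmorph_int.
Qed.

(** Multiply a monic equation of degree [n + 1] satisfied by [b^-1] by
    [b ^+ n]. *)
Lemma in_order_inv_gen (K : fieldExtType rat) (b : K) :
  b != 0 -> integralOver (intr : int -> K) b^-1 -> in_order b b^-1.
Proof.
move=> b0 [q qmon /rootP qb].
have sq : size q = (size q).-1.+1.
  by rewrite prednK // lt0n size_poly_eq0 monic_neq0.
set n := (size q).-1 in sq.
have qE : (map_poly intr q).[b^-1] =
    \sum_(k < n.+1) (q`_k)%:~R * b^-1 ^+ k :> K.
  rewrite (@horner_coef_wide _ n.+1) ?size_poly //; last first.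
    by rewrite -sq size_poly.
  by apply: eq_bigr => k _; rewrite coef_map.
have qn : q`_n = 1 by rewrite -(monicP qmon).
rewrite qb big_ord_recr /= qn mul1r in qE.
case: n => [|n] in sq qE qn *.
  by move/eqP: qE; rewrite big_ord0 add0r expr0 eq_sym oner_eq0.
exists (- \sum_(k < n.+1) q`_k *: 'X^(n - k)).
rewrite !rmorphN !rmorph_sum /=.
have := congr1 (fun y => y * b ^+ n) qE; rewrite mul0r mulrDl exprS.
rewrite -mulrA -exprMn mulVf // expr1n mulr1 => /esym/eqP.
rewrite addrC addr_eq0 => /eqP ->; congr (- _).
rewrite mulr_suml; apply: eq_bigr => k _.
rewrite map_polyZ /= map_polyXn linearZ /= rmorphXn /= horner_algX.
rewrite mulr_algl scaler_int -[RHS]mulrzl -mulrA.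
congr (_ * _).
have kn : (k <= n)%N by rewrite -ltnS.
have -> : b ^+ n = b ^+ (n - k) * b ^+ k by rewrite -exprD subnK.
by rewrite mulrCA -exprMn mulVf // expr1n mulr1.
Qed.

Lemma unit_rank1_dependent (K : fieldExtType rat) (x y : K) :
  unit_rank K 1 -> integer_unit x -> integer_unit y ->
  exists s t : int, (s != 0) || (t != 0) /\ x ^ s * y ^ t = 1.
Proof.
move=> [_ rank] xu yu; apply: contrapT => H.
pose u (i : 'I_2) := if i == 0 then x else y.
suff : (2 <= 1)%N by [].
apply: (rank 2 u) => [i|e]; first by rewrite /u; case: ifP.
rewrite big_ord_recl big_ord1 /u /= => E.
have [s0|s0] := eqVneq (e ord0) 0; last first.
  by case: H; exists (e ord0), (e (lift ord0 ord0)); rewrite s0.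
have [t0|t0] := eqVneq (e (lift ord0 ord0)) 0; last first.
  by case: H; exists (e ord0), (e (lift ord0 ord0)); rewrite t0 orbT.
move=> i; have [->//|i0] := eqVneq i ord0.
by rewrite -t0; congr e; apply: val_inj; case: i i0 => [[|[|]]].
Qed.

Theorem theoremD (R : realType) (beta : R) (K : fieldExtType rat)
    (b : K) (sigma : {rmorphism K -> R}) (I : set nat) :
  pisot_unit beta ->
  sigma b = beta ->
  <<1; b>>%VS = {:K}%VS ->
  unit_rank K 1 ->
  genpoly_subset R [set b ^+ i | i in I].
Proof.
move=> [beta1 beta_int betaV_int pisot] sb gen rank; subst beta.
have b_gen x : exists P, x = horner_alg b P.
  by apply/Fadjoin1_polyP; rewrite gen memvf.
have b0 : b != 0 by apply: contraTneq beta1 => ->; rewrite rmorph0 ltr10.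
have b_int := integralOver_fmorph beta_int.
have bV_int : integralOver (intr : int -> K) b^-1.
  by apply: (integralOver_fmorph (f := sigma)); rewrite fmorphV.
have [p [p_mon p_sep] p_ker] := integral_minimal_polynomial b_int.
have bV := in_order_inv_gen b0 bV_int.
suff [F gF FE] : genpoly_fun (\1_[set b ^+ i | i in I] : K -> R).
  exists (fun v => (F v)%:C%C); last by move=> x; rewrite FE.
  by split=> //; exact: genpoly_cst.
apply: (genpoly_powers p_mon p_ker b_gen p_sep beta1 _ bV).
  move=> a ra; apply: pisot; exists (map_poly intr p) => //.
  split; [exact: monic_map | exact: (root_gen p_ker b_gen) |].
  move=> q q0 qb; apply: dvdp_leq => //; rewrite -p_ker.
  apply/eqP/(fmorph_inj sigma)/(@complexI R).
  rewrite rmorph0 -(embed_real p_ker b_gen) embed_ev //.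
    exact/rootP.
  exact: (root_gen p_ker b_gen).
have order_integer_unit x : order_unit b x -> integer_unit x.
  by move=> [x0 x1 x2]; split=> //; apply: (in_order_integral b_int).
move=> x xu; apply: unit_rank1_dependent => //; apply: order_integer_unit => //.
Qed.
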